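(* Let $d\ge 1$, let $A=M_d(\mathbb C)$, and let $\mathscr H$ be a Hilbert module over $A$. Suppose there exist vectors $g,h\in\mathscr H$ with $[g,h]=I$ (the identity matrix). Let $T:\mathscr H\to\mathscr H$ be a surjective map (linearity is not assumed) such that \[ |[Tf,Tf']|=|[f,f']|\qquad(f,f'\in\mathscr H). \] If $d>1$, then there exist an $A$-unitary operator $U:\mathscr H\to\mathscr H$ and a phase-function $\varphi:\mathscr H\to\mathbb C$ such that $Tf=\varphi(f)Uf$ for all $f\in\mathscr H$. If $d=1$, then there exist an operator $U$ on $\mathscr H$ which is either unitary or antiunitary and a phase-function $\varphi:\mathscr H\to\mathbb C$ such that $Tf=\varphi(f)Uf$ for all $f\in\mathscr H$.
   Context: For a $C^*$-algebra $A$, a (left) Hilbert $A$-module is a left $A$-module $\mathscr H$ with a map $[\cdot,\cdot]:\mathscr H\times\mathscr H\to A$ such that for all $f,g,h\in\mathscr H$, $a\in A$: $[f+g,h]=[f,h]+[g,h]$; $[af,g]=a[f,g]$; $[g,f]=[f,g]^*$; $[f,f]\ge 0$, and $[f,f]=0$ iff $f=0$; and $\mathscr H$ is complete in the norm $f\mapsto\|[f,f]\|^{1/2}$. For $A=M_d(\mathbb C)$, $\mathscr H$ is a complex vector space (scalar $\lambda$ acting as $\lambda I$) and a Hilbert space with inner product $\langle f,g\rangle=\operatorname{tr}[f,g]$. For $a\in A$, $|a|=(a^*a)^{1/2}$. A linear bijection $U:\mathscr H\to\mathscr H$ is $A$-unitary if $U(af)=aUf$ and $[Uf,Uf']=[f,f']$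 for all $f,f'\in\mathscr H$, $a\in A$. When $d=1$ (so $\mathscr H$ is a complex Hilbert space with $[\cdot,\cdot]$ its inner product), $U$ is unitary if it is an inner-product-preserving linear bijection, and antiunitary if it is a conjugate-linear bijection with $[Uf,Uf']=[f',f]$ for all $f,f'$. A phase-function is a function $\varphi:\mathscr H\to\mathbb C$ with $|\varphi(f)|=1$ for all $f$. *)

(* Defs.v *)
From HB Require Import structures.
From mathcomp Require Import all_boot all_order all_algebra.
From mathcomp Require Import all_classical all_reals.
From mathcomp.real_closed Require Import complex.
From Stdlib Require Import ClassicalEpsilon.
Set Implicit Arguments. Unset Strict Implicit. Unset Printing Implicit Defensive.
Import Order.TTheory GRing.Theory Num.Theory.
Local Open Scope ring_scope.
Local Open Scope complex_scope.

(* Complex numbers over a real field R : realType (any realType is isomorphic to the reals). *)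
Notation Cx R := (complex R).

Section Defs.
Variable R : realType.
Local Notation C := (Cx R).

Definition adj m n (a : 'M[C]_(m, n)) : 'M[C]_(n, m) := (map_mx conjc a)^T.

Definition psd d (a : 'M[C]_d) : Prop := exists b : 'M[C]_d, a = adj b *m b.

Definition absm d (a : 'M[C]_d) : 'M[C]_d :=
  epsilon (inhabits 0) (fun b : 'M[C]_d => psd b /\ b *m b = adj a *m a).

Definition vnorm2 d (v : 'cV[C]_d) : R := \sum_i Normc.normc (v i 0) ^+ 2.

Definition opnorm d (a : 'M[C]_d) : R :=
  sup [set Num.sqrt (vnorm2 (a *m v)) | v in [set v : 'cV[C]_d | vnorm2 v <= 1]].

Definition hnorm n (H : lmodType 'M[C]_n.+1) (ip : H -> H -> 'M[C]_n.+1) (f : H) : R :=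
  Num.sqrt (opnorm (ip f f)).

Definition hilbert_module n (H : lmodType 'M[C]_n.+1)
    (ip : H -> H -> 'M[C]_n.+1) : Prop :=
  (forall f g h : H, ip (f + g) h = ip f h + ip g h) /\
      (forall (a : 'M[C]_n.+1) (f g : H), ip (a *: f) g = a * ip f g) /\
      (forall f g : H, ip g f = adj (ip f g)) /\
      (forall f : H, psd (ip f f)) /\
      (forall f : H, ip f f = 0 <-> f = 0) /\
      (forall u : nat -> H,
         (forall e : R, 0 < e -> exists N, forall m k, (N <= m)%N -> (N <= k)%N ->
              hnorm ip (u m - u k) < e) ->
         exists f : H, forall e : R, 0 < e -> exists N, forall k, (N <= k)%N ->
              hnorm ip (u k - f) < e).

Definition A_unitary n (H : lmodType 'M[C]_n.+1) (ip : H -> H -> 'M[C]_n.+1)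
    (U : H -> H) : Prop :=
  [/\ bijective U,
      (forall f g : H, U (f + g) = U f + U g),
      (forall (a : 'M[C]_n.+1) (f : H), U (a *: f) = a *: U f) &
      (forall f g : H, ip (U f) (U g) = ip f g)].

(* unitary / antiunitary in the complex-vector-space sense (used for d = 1);
   complex scalars act as lambda I *)
Definition unitary n (H : lmodType 'M[C]_n.+1) (ip : H -> H -> 'M[C]_n.+1) (U : H -> H) : Prop :=
  [/\ bijective U,
      (forall f g : H, U (f + g) = U f + U g),
      (forall (l : C) (f : H), U (l%:M *: f) = l%:M *: U f) &
      (forall f g : H, ip (U f) (U g) = ip f g)].

Definition antiunitary n (H : lmodType 'M[C]_n.+1) (ip : H -> H -> 'M[C]_n.+1) (U : H -> H) : Prop :=
  [/\ bijective U,
      (forall f g : H, U (f + g) = U f + U g),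
      (forall (l : C) (f : H), U (l%:M *: f) = (conjc l)%:M *: U f) &
      (forall f g : H, ip (U f) (U g) = ip g f)].

Definition phase_function (H : Type) (phi : H -> C) : Prop :=
  forall f, Normc.normc (phi f) = 1.

End Defs.

(* Main.v *)
Require Import Defs.
From HB Require Import structures.
From mathcomp Require Import all_boot all_order all_algebra.
From mathcomp Require Import all_classical all_reals.
From mathcomp.real_closed Require Import complex.
From mathcomp Require Import ring.
From Stdlib Require Import ClassicalEpsilon.
Import Order.TTheory GRing.Theory Num.Theory.
Local Open Scope ring_scope.
Set Implicit Arguments.
Unset Strict Implicit.
Unset Printing Implicit Defensive.

(** The squared hypothesis says that T preserves [f, f']^*[f, f'].  With
    e = E_00, the corner K = eH is a complex pre-Hilbert space and H is K^d, the
    matrix [f, g] having entries <f_i, g_j> for the coordinates f_i = E_0i f.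
    As T preserves [f, f]^2, it maps K onto K and preserves |<k, l>| there, so
    Wigner's theorem provides U on K, unitary or antiunitary, with
    T k = (phase) U k.  Taking k in K as first argument of the hypothesis and
    f in H as second argument gives
      conj <Uk, (Tf)_i> <Uk, (Tf)_j> = conj <k, f_i> <k, f_j>.
    If U is unitary, polarizing in k shows that (Tf)_i = c U f_i with one phase
    c for all i.  If U is antiunitary and d > 1, the polarized identity fails
    for f = h, tested on the coordinates of g, where [g, h] = 1.

    Wigner's theorem is proved following Bargmann: for a unit vector e and u
    orthogonal to e, T(e + u) is proportional to Te + Vu with Vu orthogonal to
    Te.  Then V preserves Re <u, v> and (Im <u, v>)^2, hence is linear or
    conjugate linear. *)

(** * Complex inner product spaces *)

Definition inner_product (C : numClosedFieldType) (K : lmodType C)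
    (dot : K -> K -> C) : Prop :=
  [/\ forall u v w, dot (u + v) w = dot u w + dot v w,
      forall a u v, dot (a *: u) v = a * dot u v,
      forall u v, dot v u = (dot u v)^*,
      forall u, 0 <= dot u u &
      forall u, dot u u = 0 -> u = 0].

Section InnerProduct.
Variables (C : numClosedFieldType) (K : lmodType C) (dot : K -> K -> C).
Hypothesis dotP : inner_product dot.

Lemma dotDl u v w : dot (u + v) w = dot u w + dot v w.
Proof. by case: dotP. Qed.

Lemma dotZl a u v : dot (a *: u) v = a * dot u v.
Proof. by case: dotP. Qed.

Lemma dotC u v : dot v u = (dot u v)^*.
Proof. by case: dotP. Qed.

Lemma dot_ge0 u : 0 <= dot u u.
Proof. by case: dotP. Qed.

Lemma dot_eq0 u : dot u u = 0 -> u = 0.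
Proof. by case: dotP => _ _ _ _; apply. Qed.

Lemma dotDr u v w : dot w (u + v) = dot w u + dot w v.
Proof. by rewrite dotC dotDl rmorphD /= -!dotC. Qed.

Lemma dotZr a u v : dot u (a *: v) = a^* * dot u v.
Proof. by rewrite dotC dotZl rmorphM /= -dotC. Qed.

Lemma dot0l v : dot 0 v = 0.
Proof. by rewrite -(scale0r 0) dotZl mul0r. Qed.

Lemma dot0r v : dot v 0 = 0.
Proof. by rewrite dotC dot0l rmorph0. Qed.

Lemma dotNl u v : dot (- u) v = - dot u v.
Proof. by rewrite -scaleN1r dotZl mulN1r. Qed.

Lemma dotNr u v : dot v (- u) = - dot v u.
Proof. by rewrite dotC dotNl rmorphN /= -dotC. Qed.

Definition dotE := (dotDl, dotNl, dotDr, dotNr, dotZl, dotZr).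

Lemma dot_conj u : (dot u u)^* = dot u u.
Proof. by rewrite -dotC. Qed.

Lemma norm_dot u : `|dot u u| = dot u u.
Proof. by rewrite ger0_norm ?dot_ge0. Qed.

Lemma dot_inj u v : (forall w, dot w u = dot w v) -> u = v.
Proof.
move=> uv; apply/eqP; rewrite -subr_eq0; apply/eqP; apply: dot_eq0.
by rewrite dotDr dotNr uv subrr.
Qed.

(** Scaling by <v, v> instead of dividing keeps the identity valid for v = 0; it yields both
    Cauchy-Schwarz and its equality case. *)
Lemma dot_lagrange u v :
  dot (dot v v *: u - dot u v *: v) (dot v v *: u - dot u v *: v) =
  dot v v * (dot u u * dot v v - `|dot u v| ^+ 2).
Proof.
rewrite !dotE dot_conj normCK. rewrite (dotC u v).
by ring.
Qed.

Lemma cauchy_schwarz u v : `|dot u v| ^+ 2 <= dot u u * dot v v.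
Proof.
have [/dot_eq0 ->|v0] := eqVneq (dot v v) 0.
  by rewrite !dot0r normr0 expr0n mulr0.
rewrite -subr_ge0 -(@pmulr_rge0 _ (dot v v)) ?lt0r ?v0 ?dot_ge0 //.
by rewrite -dot_lagrange dot_ge0.
Qed.

(** Equality in Cauchy-Schwarz: the left side of [dot_lagrange] vanishes, so u and v are
    proportional, and equal norms make the factor a phase. *)
Lemma dot_phase u v : dot v v = dot u u -> `|dot u v| = dot u u ->
  exists2 c, `|c| = 1 & u = c *: v.
Proof.
move=> vu duv; have [u0|u0] := eqVneq (dot u u) 0.
  exists 1; first exact: normr1.
  by rewrite (dot_eq0 u0) (dot_eq0 (etrans vu u0)) scaler0.
exists (dot u v / dot u u); first by rewrite normrM normfV duv norm_dot divff.
have /dot_eq0/eqP : dot (dot v v *: u - dot u v *: v)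
                        (dot v v *: u - dot u v *: v) = 0.
  by rewrite dot_lagrange duv vu expr2 subrr mulr0.
rewrite vu subr_eq0 => /eqP e.
by rewrite mulrC -scalerA -e scalerA mulVf ?scale1r.
Qed.

(** The diagonal at u + v gives F v u = - F u v; at u + iv it gives - i F u v + i F v u = 0.
    Together, - 2i F u v = 0. *)
Lemma sesquilinear_polarization (F : K -> K -> C) :
    (forall u v w, F (u + v) w = F u w + F v w) ->
    (forall u v w, F w (u + v) = F w u + F w v) ->
    (forall a u v, F (a *: u) v = a * F u v) ->
    (forall a u v, F u (a *: v) = a^* * F u v) ->
  (forall u, F u u = 0) -> forall u v, F u v = 0.
Proof.
move=> FDl FDr FZl FZr F0 u v.
have := F0 (u + v); rewrite FDl !FDr !F0 add0r addr0 => e1.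
have := F0 (u + 'i *: v); rewrite FDl !FDr FZl !FZr FZl !F0 !mulr0 add0r addr0.
rewrite conjCi -(addr0_eq e1) => e2; apply/eqP.
rewrite -(mulrI_eq0 _ (mulfI (_ : (- 'i *+ 2 : C) != 0))); last first.
  by rewrite mulrn_eq0 oppr_eq0 neq0Ci.
rewrite -[X in _ == X]e2; apply/eqP; ring.
Qed.

End InnerProduct.

(** * Wigner's theorem *)

Lemma wigner (C : numClosedFieldType) (K : lmodType C) (dot : K -> K -> C)
    (T : K -> K) :
  inner_product dot -> (forall u v, `|dot (T u) (T v)| = `|dot u v|) ->
  exists2 th : {rmorphism C -> C}, th =1 id \/ th =1 Num.conj &
  exists U : K -> K,
    [/\ forall u v, U (u + v) = U u + U v,
        forall a u, U (a *: u) = th a *: U u,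
        forall u v, dot (U u) (U v) = th (dot u v) &
        forall u, exists2 c, `|c| = 1 & T u = c *: U u].
Proof.
move=> dotP T_dot; have DE := dotE dotP.
have TT u : dot (T u) (T u) = dot u u.
  by have := T_dot u u; rewrite !(norm_dot dotP).
have [[x x0]|K0] := pselect (exists x : K, x != 0); last first.
  have {}K0 (u : K) : u = 0.
    by apply/eqP/negP => /negP u0; apply: K0; exists u.
  exists idfun; first by left.
  exists id; split=> // u; exists 1; first exact: normr1.
  by rewrite [RHS]K0; apply: K0.
have dx0 : dot x x != 0 by apply: contra_neq x0; apply: dot_eq0.
pose e := (sqrtC (dot x x))^-1 *: x.
have ee : dot e e = 1.
  rewrite !DE mulrA -normCK normfV ger0_norm ?sqrtC_ge0 ?(dot_ge0 dotP) //.
  by rewrite exprVn sqrtCK mulVf.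
clearbody e; clear x x0 dx0; pose e' := T e.
have e'e' : dot e' e' = 1 by rewrite /e' TT.
(* For u orthogonal to e the divisor has modulus |<e + u, e>| = 1; dividing fixes the free phase of
   T(e + u), making its component along e' equal to e'. *)
pose V u := (dot (T (e + u)) e')^-1 *: T (e + u) - e'.
pose P u := dot u e = 0.
have PC u : P u -> dot e u = 0 by move=> Pu; rewrite (dotC dotP) Pu rmorph0.
have PD u v : P u -> P v -> P (u + v).
  by rewrite /P DE => -> ->; rewrite addr0.
have PZ a u : P u -> P (a *: u) by rewrite /P DE => ->; rewrite mulr0.
have V_phase u : P u -> exists2 c, `|c| = 1 & e' + V u = c *: T (e + u).
  move=> Pu; exists (dot (T (e + u)) e')^-1; last by rewrite addrC subrK.
  by rewrite normfV T_dot DE ee Pu addr0 normr1 invr1.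
have Ve u : P u -> dot (V u) e' = 0.
  move=> Pu; rewrite !DE e'e' mulVf ?subrr // -normr_eq0 T_dot DE ee Pu.
  by rewrite addr0 normr1 oner_eq0.
clearbody V.
have eV u : P u -> dot e' (V u) = 0.
  by move=> Pu; rewrite (dotC dotP) Ve // rmorph0.
have V1 u v : P u -> P v -> `|1 + dot (V u) (V v)| = `|1 + dot u v|.
  move=> Pu Pv.
  have -> : 1 + dot (V u) (V v) = dot (e' + V u) (e' + V v).
    by rewrite !DE e'e' Ve // eV // addr0 add0r.
  have [c c1 ->] := V_phase u Pu; have [c' c'1 ->] := V_phase v Pv.
  rewrite !DE !normrM norm_conjC c1 c'1 !mul1r T_dot !DE ee Pu PC //.
  by rewrite addr0 add0r.
have VV u : P u -> dot (V u) (V u) = dot u u.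
  move=> Pu; have := V1 u u Pu Pu.
  by rewrite !ger0_norm ?addr_ge0 ?ler01 ?(dot_ge0 dotP) // => /addrI.
(* [1 + <Vu, V(2u)>] has modulus [1 + 2 |u|^2]: the equality case of
   Cauchy-Schwarz. *)
have V2 u : P u -> V (2 *: u) = 2 *: V u.
  move=> Pu; apply/eqP; rewrite -subr_eq0; apply/eqP/(dot_eq0 dotP)/eqP.
  rewrite eq_le (dot_ge0 dotP) andbT.
  have Pu2 := PZ 2 u Pu.
  have := cauchy_schwarz dotP (V u) (V (2 *: u)).
  have /(congr1 (fun y => y ^+ 2)) := V1 u _ Pu Pu2.
  rewrite !normCK !rmorphD /= -!(dotC dotP) !DE !VV // !DE.
  rewrite !conjC_nat !rmorph1; set s := dot u u.
  set z := dot (V u) _; set z' := dot _ (V u) => E1 E2.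
  have -> : 2 * (2 * s) - 2 * z' - (2 * z - 2 * (2 * s)) =
      2 * (z * z' - s * (2 * (2 * s))).
    have -> : z * z' = (1 + z) * (1 + z') - 1 - z - z' by ring.
    rewrite E1; ring.
  by rewrite pmulr_rle0 ?subr_le0 ?ltr0n.
(* Twice the real part and 2i times the imaginary part of <u, v>. *)
pose re u v := dot u v + dot v u.
pose im u v := dot u v - dot v u.
(* Expands |1 + z|^2 = 1 + 2 Re z + |z|^2 on both sides of [V1]. *)
have V_sq u v : P u -> P v -> re (V u) (V v) + dot (V u) (V v) * dot (V v) (V u)
    = re u v + dot u v * dot v u.
  move=> Pu Pv; have /(congr1 (fun y => y ^+ 2)) := V1 u v Pu Pv.
  rewrite !normCK !rmorphD /= -!(dotC dotP) !rmorph1 /re => E.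
  have -> : forall a b : C, a + b + a * b = (1 + a) * (1 + b) - 1.
    by move=> *; ring.
  by rewrite E; ring.
have n2 : (2 : C) != 0 by rewrite pnatr_eq0.
have inj2 (a b : C) : a *+ 2 = b *+ 2 -> a = b.
  by rewrite -(mulr_natl a) -(mulr_natl b) => /(mulfI n2).
(* Compares V_sq for [v] and [2v]. *)
have V_re u v : P u -> P v -> re (V u) (V v) = re u v.
  move=> Pu Pv; have := V_sq u _ Pu (PZ 2 v Pv).
  have := V_sq u v Pu Pv; rewrite V2 // /re !DE conjC_nat => E1 E2.
  have ex (a b : C) :
      2 * (a + b) = 4%:R * (a + b + a * b) - (2 * a + 2 * b + 2 * a * (2 * b)).
    by ring.
  by apply/(mulfI n2); rewrite ex E1 E2 -ex.
have V_mul u v : P u -> P v ->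
    dot (V u) (V v) * dot (V v) (V u) = dot u v * dot v u.
  by move=> Pu Pv; have := V_sq u v Pu Pv; rewrite V_re // => /addrI.
have V_im u v : P u -> P v -> im (V u) (V v) ^+ 2 = im u v ^+ 2.
  move=> Pu Pv.
  have im2 a b : im a b ^+ 2 = re a b ^+ 2 - 4%:R * (dot a b * dot b a).
    by rewrite /im /re; ring.
  by rewrite !im2 V_re // V_mul.
have VD u v : P u -> P v -> V (u + v) = V u + V v.
  move=> Pu Pv; have Puv := PD _ _ Pu Pv.
  apply/eqP; rewrite -subr_eq0; apply/eqP/(dot_eq0 dotP).
  (* This squared norm involves only norms and [re], which V preserves; so its value at Vu, Vv, V(u
     + v) is its value at u, v, u + v, namely 0. *)
  have ex a b c : dot (c - (a + b)) (c - (a + b)) =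
      dot a a + dot b b + dot c c - re c a - re c b + re a b.
    by rewrite /re !DE; ring.
  by rewrite ex !VV // !V_re // -ex subrr (dot0l dotP).
have imDl a b c : im (a + b) c = im a c + im b c by rewrite /im !DE; ring.
have imDr a b c : im c (a + b) = im c a + im c b by rewrite /im !DE; ring.
have half a b : dot a b *+ 2 = re a b + im a b by rewrite /re /im; ring.
have halfC a b : dot b a *+ 2 = re a b - im a b by rewrite /re /im; ring.
have imN a b : im a b = - im b a by rewrite /im opprB.
clearbody re im.
(* Two biadditive forms with equal squares agree up to a global sign. *)
have im_sign u0 v0 ep : P u0 -> P v0 -> im u0 v0 != 0 -> ep * ep = 1 ->
    im (V u0) (V v0) = ep * im u0 v0 ->
    forall u v, P u -> P v -> im (V u) (V v) = ep * im u v.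
  move=> Pu0 Pv0 i0 ep1 E0.
  (* Polarizes [V_im] in its second argument, V being additive. *)
  have polr u v v' : P u -> P v -> P v' ->
      im (V u) (V v) * im (V u) (V v') = im u v * im u v'.
    move=> Pu Pv Pv'; have := V_im u (v + v') Pu (PD _ _ Pv Pv').
    by rewrite VD // !imDr !sqrrD !V_im // => /addIr/addrI/inj2.
  have poll a b v : P a -> P b -> P v ->
      im (V a) (V v) * im (V b) (V v) = im a v * im b v.
    by move=> Pa Pb Pv; rewrite !(imN _ v) !(imN _ (V v)) !mulrNN polr.
  have ep0 : ep != 0.
    by apply/eqP => ep0; move/eqP: ep1; rewrite ep0 mul0r eq_sym oner_eq0.
  have epK a b : ep * (a * (ep * b)) = a * b.
    by rewrite mulrCA [ep * (ep * b)]mulrA ep1 mul1r.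
  have Er v : P v -> im (V u0) (V v) = ep * im u0 v.
    by move=> Pv; apply/(mulfI i0)/(mulfI ep0); rewrite epK mulrA -E0 polr.
  have El u : P u -> im (V u) (V v0) = ep * im u v0.
    by move=> Pu; apply/(mulfI i0)/(mulfI ep0); rewrite epK mulrA -E0 poll.
  move=> u v Pu Pv.
  (* Of the four products, those sharing a first argument cancel by [polr]. [El] and [Er] evaluate
     one of the two cross terms; the other contains the unknown im (Vu) (Vv). *)
  have := polr (u0 + u) v0 v (PD _ _ Pu0 Pu) Pv0 Pv.
  rewrite VD // !imDl !mulrDl !mulrDr.
  rewrite polr // [im (V u) (V v0) * im (V u) (V v)]polr //.
  rewrite E0 El // Er // => E; apply/(mulfI i0)/(mulfI ep0).
  have {}E : ep * (im u0 v0 * im (V u) (V v)) =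
      im u0 v0 * im u v + im u v0 * im u0 v - (ep * ep) * (im u v0 * im u0 v).
    move/eqP: E; rewrite -subr_eq0 => /eqP E; apply/eqP.
    by rewrite -subr_eq0 -[X in _ == X]E; apply/eqP; ring.
  rewrite E ep1 mul1r addrK.
  by rewrite epK.
(* The morphism [th] covers the linear and the conjugate linear case, so U is built once. If V does
   not preserve [im] throughout, some pair has sign -1 with im nonzero, and [im_sign] spreads this
   sign to all pairs. *)
have [th [thE thJ Vth]] : exists th : {rmorphism C -> C},
    [/\ th =1 id \/ th =1 Num.conj, forall a, th a^* = (th a)^* &
        forall u v, P u -> P v -> dot (V u) (V v) = th (dot u v)].
  have [same|] := pselect (forall u v, P u -> P v -> im (V u) (V v) = im u v).
    exists idfun; split=> [|//|u v Pu Pv]; first by left.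
    by apply/inj2; rewrite !half V_re // same.
  move=> /existsNP[u0 /existsNP[v0]] /not_implyP[Pu0] /not_implyP[Pv0] ne.
  have E0 : im (V u0) (V v0) = - 1 * im u0 v0.
    have /eqP := V_im u0 v0 Pu0 Pv0; rewrite eqf_sqr => /orP[/eqP//|/eqP ->].
    by rewrite mulN1r.
  have i0 : im u0 v0 != 0.
    by apply/eqP => i0; apply: ne; rewrite E0 i0 mulr0.
  exists Num.conj; split=> [|//|u v Pu Pv]; first by right.
  rewrite /= -(dotC dotP); apply/inj2; rewrite half halfC V_re //.
  by rewrite (im_sign _ _ _ Pu0 Pv0 i0 _ E0) // ?mulrNN ?mulr1 // mulN1r.
have th_norm a : `|th a| = `|a|.
  by case: thE => ->; rewrite ?norm_conjC.
have th_dot u : th (dot u u) = dot u u.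
  by case: thE => -> //; rewrite (dot_conj dotP).
have VZ a u : P u -> V (a *: u) = th a *: V u.
  move=> Pu; have Pau := PZ a u Pu.
  apply/eqP; rewrite -subr_eq0; apply/eqP/(dot_eq0 dotP).
  by rewrite !DE !Vth // !DE !rmorphM /= thJ; ring.
pose pr u := u - dot u e *: e.
have Ppr u : P (pr u) by rewrite /P /pr !DE ee mulr1 subrr.
have prD u v : pr (u + v) = pr u + pr v.
  by rewrite /pr DE scalerDl opprD addrACA.
have prZ a u : pr (a *: u) = a *: pr u.
  by rewrite /pr DE -scalerA scalerBr.
have pr_id u : P u -> pr u = u by move=> Pu; rewrite /pr Pu scale0r subr0.
(* U sends e to e' and acts as V on the orthogonal complement of e. *)
pose U u := th (dot u e) *: e' + V (pr u).
have UD u v : U (u + v) = U u + U v.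
  by rewrite /U prD VD // DE rmorphD scalerDl addrACA.
have UZ a u : U (a *: u) = th a *: U u.
  by rewrite /U prZ VZ // DE rmorphM -scalerA scalerDr.
have U_dot u v : dot (U u) (U v) = th (dot u v).
  have -> : dot u v = dot u e * (dot v e)^* + dot (pr u) (pr v).
    rewrite /pr !DE ee -(dotC dotP); ring.
  rewrite /U rmorphD rmorphM /= thJ -(Vth (pr u) (pr v)) //.
  by rewrite !DE e'e' Ve // eV //; ring.
exists th => //; exists U; split=> // u.
(* It remains to show |<Tu, Uu>| = <u, u>. *)
apply: (dot_phase dotP); rewrite TT; first by rewrite U_dot th_dot.
(* V describes T only on vectors e + u. If u is orthogonal to e, then Tu is orthogonal to e', so e'
   can be added to Uu without changing <Tu, Uu>. *)
have [Pu|u0] := eqVneq (dot u e) 0.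
  have -> : dot (T u) (U u) = dot (T u) (e' + V u) - dot (T u) e'.
    by rewrite /U Pu pr_id // rmorph0 scale0r add0r DE addrC addKr.
  have -> : dot (T u) e' = 0 by apply/normr0_eq0; rewrite T_dot Pu normr0.
  have [c c1 ->] := V_phase u Pu.
  rewrite subr0 DE normrM norm_conjC c1 mul1r T_dot DE.
  by rewrite Pu add0r (norm_dot dotP).
(* Now u = a(e + w). As T is not known to be homogeneous, Tu and T(e + w) are compared only through
   the modulus of their inner product. *)
pose a := dot u e; pose w := a^-1 *: pr u.
have uE : u = a *: (e + w).
  by rewrite scalerDr scalerA mulfV // scale1r addrC subrK.
have Pw : P w by apply: PZ.
have -> : dot (T u) (U u) = (th a)^* * dot (T u) (e' + V w).
  rewrite -DE; congr (dot _ _); rewrite {1}uE UZ; congr (_ *: _).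
  rewrite /U DE ee Pw addr0 rmorph1 scale1r /pr DE ee Pw addr0 scale1r.
  by rewrite addrAC subrr add0r.
have [c c1 ->] := V_phase w Pw.
rewrite DE !normrM !norm_conjC c1 mul1r th_norm T_dot -(norm_conjC a) -normrM.
rewrite -(dotZr dotP) -uE; exact: (norm_dot dotP).
Qed.

(** * Positive square roots of matrices *)

Section SquareRoot.
Variable F : numClosedFieldType.
Local Notation "a ^*t" := (map_mx Num.conj a^T) (at level 30).

Lemma mul_trC_diag m n (a : 'M[F]_(m, n)) i :
  (a ^*t *m a) i i = \sum_k `|a k i| ^+ 2.
Proof.
by rewrite mxE; apply: eq_bigr => k _; rewrite !mxE normCK mulrC.
Qed.

(** The spectral theorem diagonalizes the normal matrix a^* a by a unitary P. Its eigenvalues are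
    diagonal entries of the Gram matrix of a P^*, hence nonnegative. *)
Lemma psd_sqrt_exists d (a : 'M[F]_d) :
  exists c : 'M[F]_d, (c ^*t *m c) *m (c ^*t *m c) = a ^*t *m a.
Proof.
have trCM (x y : 'M[F]_d) : (x *m y) ^*t = y ^*t *m x ^*t.
  by rewrite trmx_mul map_mxM.
have trCK (x : 'M[F]_d) : (x ^*t) ^*t = x.
  by apply/matrixP=> i j; rewrite !mxE conjCK.
have /orthomx_spectral_subproof[[P D] /= PU defA] : a ^*t *m a \is normalmx.
  by apply/normalmxP; rewrite trCM trCK.
have /unitarymxP PV := PU; rewrite invmx_unitary // in defA.
have D_ge0 i : 0 <= D 0 i.
  have -> : D 0 i = ((a *m P ^*t) ^*t *m (a *m P ^*t)) i i.
    rewrite trCM trCK mulmxA -[_ *m _ *m a]mulmxA defA !mulmxA PV mul1mx.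
    by rewrite -mulmxA PV mulmx1 mxE eqxx mulr1n.
  by rewrite mul_trC_diag sumr_ge0 // => k _; rewrite exprn_ge0.
(* The root s of D gives the square root P^* s P; the second root t writes it as c^* c with c = t P,
   which certifies positivity. *)
pose s := \row_i sqrtC (D 0 i); pose t := \row_i sqrtC (s 0 i).
have tt : (diag_mx t) ^*t *m diag_mx t = diag_mx s.
  apply/matrixP=> i j; rewrite mul_mx_diag !mxE eq_sym.
  have [->|ne] := eqVneq i j; last by rewrite !mulr0n rmorph0 mul0r.
  rewrite !mulr1n (CrealP _); first by rewrite -expr2 sqrtCK.
  by rewrite ger0_real ?sqrtC_ge0.
have ss : diag_mx s *m diag_mx s = diag_mx D.
  apply/matrixP=> i j; rewrite mul_mx_diag !mxE.
  by case: eqVneq => [->|_]; rewrite ?mulr0n ?mul0r // !mulr1n -expr2 sqrtCK.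
exists (diag_mx t *m P).
have -> : (diag_mx t *m P) ^*t *m (diag_mx t *m P) = P ^*t *m diag_mx s *m P.
  by rewrite trCM mulmxA -[_ *m _ *m diag_mx t]mulmxA tt.
rewrite defA !mulmxA -[_ *m P *m _]mulmxA PV mulmx1.
by rewrite -[_ *m diag_mx s *m diag_mx s]mulmxA ss.
Qed.

End SquareRoot.

(** * Adjoints and the matrix absolute value *)

Section MatrixAdjoint.
Variable R : realType.
Local Notation C := (complex R).

Lemma adjE m n (a : 'M[C]_(m, n)) i j : adj a i j = (a j i)^*.
Proof. by rewrite !mxE. Qed.

Lemma adjM m n p (a : 'M[C]_(m, n)) (b : 'M[C]_(n, p)) :
  adj (a *m b) = adj b *m adj a.
Proof. by rewrite /adj map_mxM trmx_mul. Qed.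

Lemma adj_trC m n (a : 'M[C]_(m, n)) : adj a = map_mx Num.conj (a^T).
Proof. by apply/matrixP=> i j; rewrite adjE !mxE. Qed.

Lemma adj_delta m n i j : adj (delta_mx i j : 'M[C]_(m, n)) = delta_mx j i.
Proof. by apply/matrixP=> k l; rewrite adjE !mxE conjC_nat andbC. Qed.

Lemma adj_mul_diag_ge0 m n (a : 'M[C]_(m, n)) i : 0 <= (adj a *m a) i i.
Proof.
by rewrite adj_trC mul_trC_diag sumr_ge0 // => k _; rewrite exprn_ge0.
Qed.

(** [absm] is an epsilon choice, so its specification follows from the existence of a positive root.
    This turns equality of absolute values into equality of Gram matrices. *)
Lemma absm_sqr d (a : 'M[C]_d) : absm a *m absm a = adj a *m a.
Proof.
have ex : exists b : 'M[C]_d, psd b /\ b *m b = adj a *m a.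
  have [c cE] := psd_sqrt_exists a; rewrite -!adj_trC in cE.
  by exists (adj c *m c); split; first exists c.
by case: (epsilon_spec (inhabits 0) _ ex).
Qed.

End MatrixAdjoint.

(** * Families of vectors determined by products of their inner products *)

Section LocalProportionality.
Variables (C : numClosedFieldType) (K : lmodType C) (dot : K -> K -> C).
Hypothesis dotP : inner_product dot.

(** The difference of the two sides is sesquilinear in (u, v) and vanishes on the diagonal. *)
Lemma product_polarization a b c d :
    (forall u, dot u a * (dot u b)^* = dot u c * (dot u d)^*) ->
  forall u v, dot u a * (dot v b)^* = dot u c * (dot v d)^*.
Proof.
move=> abcd u v; apply/eqP; rewrite -subr_eq0; apply/eqP.
pose F u v := dot u a * (dot v b)^* - dot u c * (dot v d)^*.
apply: (sesquilinear_polarization (F := F)) => [x y z|x y z|s x y|s x y|x].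
- by rewrite /F !(dotDl dotP); ring.
- by rewrite /F !(dotDl dotP) !rmorphD /=; ring.
- by rewrite /F !(dotZl dotP); ring.
- by rewrite /F !(dotZl dotP) !rmorphM /=; ring.
- by rewrite /F abcd subrr.
Qed.

Variable I : Type.
Implicit Types f y : I -> K.

Lemma products_phase f y :
    (forall k i j, (dot k (y i))^* * dot k (y j) =
                   (dot k (f i))^* * dot k (f j)) ->
  exists2 c, `|c| = 1 & forall i, y i = c *: f i.
Proof.
move=> fy.
have fyp k l i j :
    dot k (y j) * (dot l (y i))^* = dot k (f j) * (dot l (f i))^*.
  by apply: product_polarization => u; rewrite mulrC fy mulrC.
have norm_fy k i : `|dot k (y i)| = `|dot k (f i)|.
  by apply/eqP; rewrite -(eqrXn2 (ltn0Sn 1)) // !normCK mulrC fy mulrC.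
have [[j fj0]|f0] := pselect (exists j, dot (f j) (f j) != 0); last first.
  have {}f0 i : f i = 0.
    apply: (dot_eq0 dotP); apply/eqP/negP => /negP fi0; apply: f0; by exists i.
  exists 1 => [|i]; first exact: normr1.
  rewrite f0 scaler0; apply: (dot_eq0 dotP); apply/normr0_eq0.
  by rewrite norm_fy f0 (dot0r dotP) normr0.
set p := dot (f j) (f j) in fj0; pose q := dot (f j) (y j).
have qp : `|q| = `|p| by rewrite norm_fy.
have q0 : q != 0 by rewrite -normr_eq0 qp normr_eq0.
(* Polarization with second test vector f j gives <k, y i> q^* = <k, f i> p for every i. The outer
   conjugate appears because the scalar sits in the second slot. *)
exists (p / q^*)^* => [|i].
  by rewrite norm_conjC normrM normfV norm_conjC qp divff ?normr_eq0.
apply: (dot_inj dotP) => k; rewrite (dotZr dotP) conjCK.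
have := fyp k (f j) j i; rewrite -/q -/p (dot_conj dotP) => e.
apply: (mulIf (_ : q^* != 0)); rewrite ?conjC_eq0 //.
by rewrite e mulrAC divfK ?conjC_eq0 // mulrC.
Qed.

(** Testing at (g i, g i) gives <g i, y j> = 0, while testing at (g i, g j) makes a product with
    this factor equal to 1. This excludes the antiunitary case when d > 1. *)
Lemma no_conjugate_products f y (g : I -> K) i j :
    (forall k i j, (dot k (y i))^* * dot k (y j) =
                   dot k (f i) * (dot k (f j))^*) ->
  dot (g i) (f i) = 1 -> dot (g j) (f j) = 1 -> dot (g i) (f j) = 0 -> False.
Proof.
move=> fy gi gj gij.
have fyp k l a b :
    dot k (y b) * (dot l (y a))^* = dot k (f a) * (dot l (f b))^*.
  by apply: product_polarization => u; rewrite mulrC fy.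
have /eqP := fyp (g i) (g i) j j.
rewrite gij mul0r -normCK sqrf_eq0 normr_eq0 => /eqP y0.
have /eqP := fyp (g i) (g j) i j.
by rewrite y0 mul0r gi gj rmorph1 mulr1 eq_sym oner_eq0.
Qed.

End LocalProportionality.

Lemma inj_surj_bij (A B : Type) (f : A -> B) :
  injective f -> (forall y, exists x, f x = y) -> bijective f.
Proof.
move=> fI /choice[g gK]; exists g => // x.
by apply: fI; rewrite gK.
Qed.

(* The corner [E_00 H] of the module; [H] is a sum of n.+1 copies of it. *)
Section Corner.
Variables (R : realType) (n : nat).
Local Notation C := (complex R).
Variable H : lmodType 'M[C]_n.+1.
Local Notation E := (fun i j => delta_mx i j : 'M[C]_n.+1).

Definition is_corner (f : H) : bool := E 0 0 *: f == f.

Fact is_corner_zmod : zmod_closed is_corner.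
Proof.
split; first by rewrite unfold_in scaler0.
move=> f g /eqP fP /eqP gP; rewrite unfold_in scalerBr; apply/eqP.
by rewrite -[in RHS]fP -[in RHS]gP.
Qed.

HB.instance Definition _ := GRing.isZmodClosed.Build H is_corner is_corner_zmod.

Record corner := Corner { corner_val : H; corner_valP : is_corner corner_val }.

HB.instance Definition _ := [isSub for corner_val].
HB.instance Definition _ := [Choice of corner by <:].
HB.instance Definition _ := [SubChoice_isSubZmodule of corner by <:].

Lemma scalar_delta (a : C) i j : a%:M * E i j = E i j * a%:M.
Proof. by rewrite -!mulmxE scalar_mxC. Qed.

Fact corner_scale_subproof (a : C) (k : corner) : is_corner (a%:M *: val k).
Proof.
apply/eqP; rewrite scalerA -scalar_delta -scalerA; congr (_ *: _).
exact/eqP/(valP k).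
Qed.

Definition corner_scale a k : corner := Sub _ (corner_scale_subproof a k).

Fact corner_scaleA a b k :
  corner_scale a (corner_scale b k) = corner_scale (a * b) k.
Proof. by apply: val_inj; rewrite /= scalerA -mulmxE -scalar_mxM. Qed.

Fact corner_scale1 : left_id 1 corner_scale.
Proof. by move=> k; apply: val_inj; rewrite /= scale1r. Qed.

Fact corner_scaleDr : right_distributive corner_scale +%R.
Proof. by move=> a k l; apply: val_inj; exact: scalerDr. Qed.

Fact corner_scaleDl k : {morph corner_scale^~ k : a b / a + b}.
Proof.
by move=> a b; apply: val_inj; rewrite [LHS]/= raddfD; apply: scalerDl.
Qed.

HB.instance Definition _ := GRing.Zmodule_isLmodule.Build C corner
  corner_scaleA corner_scale1 corner_scaleDr corner_scaleDl.

Lemma corner_valZ (a : C) (k : corner) : val (a *: k) = a%:M *: val k.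
Proof. by []. Qed.

Fact coord_subproof i (f : H) : is_corner (E 0 i *: f).
Proof. by apply/eqP; rewrite scalerA -mulmxE mul_delta_mx. Qed.

Definition corner_coord i f : corner := Sub _ (coord_subproof i f).

(** Inverse of the coordinate map, since E_0i E_j0 is E_00 for i = j and 0 otherwise, while the E_i0
    E_0i sum to the identity. *)
Definition pack (k : 'I_n.+1 -> corner) : H := \sum_i E i 0 *: val (k i).

Lemma packK k i : corner_coord i (pack k) = k i.
Proof.
apply: val_inj; rewrite /= /pack scaler_sumr (bigD1 i) //= big1 ?addr0.
  by rewrite scalerA -mulmxE mul_delta_mx; apply/eqP/(valP (k i)).
move=> j ji; rewrite scalerA -mulmxE mul_delta_mx_cond eq_sym (negPf ji).
by rewrite scale0r.
Qed.

Lemma coordK f : pack (corner_coord^~ f) = f.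
Proof.
rewrite /pack; under eq_bigr => i _ do rewrite /= scalerA -mulmxE mul_delta_mx.
by rewrite -scaler_suml -mx1_sum_delta scale1r.
Qed.

Lemma coord_inj f g : (forall i, corner_coord i f = corner_coord i g) -> f = g.
Proof. by move=> /funext fg; rewrite -(coordK f) fg coordK. Qed.

Lemma coordD i f g :
  corner_coord i (f + g) = corner_coord i f + corner_coord i g.
Proof. by apply: val_inj; rewrite /= scalerDr. Qed.

Lemma coord_scalar i (a : C) f :
  corner_coord i (a%:M *: f) = a *: corner_coord i f.
Proof. by apply: val_inj; rewrite corner_valZ /= !scalerA scalar_delta. Qed.

(** E_0i a carries row i of a in row 0, so it is the sum of the a_ij E_0j. *)
Lemma coordZ i a f : corner_coord i (a *: f) = \sum_j a i j *: corner_coord j f.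
Proof.
apply: val_inj; rewrite raddf_sum /= scalerA -mulmxE.
have -> : E 0 i *m a = \sum_j (a i j)%:M *m E 0 j.
  apply/matrixP=> k l; rewrite mxE summxE (bigD1 i) //= big1 ?addr0.
    rewrite (bigD1 l) //= big1 ?addr0.
      by rewrite mul_scalar_mx !mxE !eqxx !andbT mulrC.
    move=> j jl; rewrite mul_scalar_mx !mxE [l == j]eq_sym (negPf jl) andbF.
    by rewrite mulr0.
  by move=> j ji; rewrite mxE (negPf ji) andbF mul0r.
rewrite scaler_suml; apply: eq_bigr => j _.
by rewrite mulmxE -scalerA.
Qed.

Lemma coord_corner (k : corner) i :
  corner_coord i (val k) = if i == 0 then k else 0.
Proof.
apply: val_inj.
rewrite /= -[in LHS](eqP (valP k)) scalerA -mulmxE mul_delta_mx_cond.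
by case: eqP => _; rewrite ?scale0r // (eqP (valP k)).
Qed.

Lemma is_cornerP f :
  reflect (forall i, i != 0 -> corner_coord i f = 0) (is_corner f).
Proof.
apply: (iffP idP) => [fP i i0|f0].
  by rewrite (coord_corner (Corner fP)) (negPf i0).
suff -> : f = val (corner_coord 0 f) by apply: valP.
apply: coord_inj => i; rewrite coord_corner.
by have [->|/f0] := eqVneq i 0.
Qed.

End Corner.

(** * The matrix-valued product in corner coordinates *)

Section HilbertModule.
Variables (R : realType) (n : nat).
Local Notation C := (complex R).
Variables (H : lmodType 'M[C]_n.+1) (ip : H -> H -> 'M[C]_n.+1).
Hypothesis hH : hilbert_module ip.
Implicit Types f g : H.

Definition corner_dot (k l : corner H) : C := ip (val k) (val l) 0 0.

Lemma ipC f g : ip g f = adj (ip f g).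
Proof. by case: hH => _ [_ []]. Qed.

Lemma ipZr a f g : ip f (a *: g) = ip f g *m adj a.
Proof.
by case: hH => _ [ipZ _]; rewrite ipC ipZ adjM -ipC.
Qed.

(** The (0, 0) entry of E_0i [f, g] E_j0 is the (i, j) entry of [f, g]. *)
Lemma ip_coord f g i j :
  ip f g i j = corner_dot (corner_coord i f) (corner_coord j g).
Proof.
rewrite /corner_dot /= ipZr; case: hH => _ [-> _]; rewrite adj_delta.
rewrite -mulmxE mxE (bigD1 j) //= big1 => [|k kj]; last first.
  by rewrite [delta_mx _ _ _ _]mxE (negPf kj) mulr0.
rewrite [delta_mx j _ _ _]mxE !eqxx mulr1 addr0 mxE (bigD1 i) //= big1.
  by rewrite mxE !eqxx mul1r addr0.
by move=> k ki; rewrite mxE (negPf ki) andbF mul0r.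
Qed.

Lemma corner_dotP : inner_product corner_dot.
Proof.
case: (hH) => ipD [ipZ [_ [ip_psd [ip0 _]]]].
split=> [u v w|a u v|u v|u|u u0]; rewrite /corner_dot.
- by rewrite raddfD ipD mxE.
- by rewrite corner_valZ ipZ -mulmxE mul_scalar_mx mxE.
- by rewrite ipC adjE.
- by have [b ->] := ip_psd (val u); apply: adj_mul_diag_ge0.
(* For a corner vector, every entry of [u, u] except (0, 0) vanishes, so the scalar <u, u> alone
   decides whether u = 0. *)
apply/val_inj/ip0/matrixP=> i j.
have ip0l f : ip 0 f = 0 by rewrite -(scale0r (0 : H)) ipZ mul0r.
rewrite ip_coord !coord_corner mxE /corner_dot.
case: eqP => _; last by rewrite raddf0 ip0l mxE.
case: eqP => _ //; by rewrite ipC raddf0 ip0l adjE mxE rmorph0.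
Qed.

Lemma gram_entry f g i j :
  (adj (ip f g) *m ip f g) i j =
  \sum_l (corner_dot (corner_coord l f) (corner_coord i g))^* *
          corner_dot (corner_coord l f) (corner_coord j g).
Proof. by rewrite mxE; apply: eq_bigr => l _; rewrite adjE !ip_coord. Qed.

(** A corner vector has only its coordinate 0, so the sum in [gram_entry] collapses to one
    product. *)
Lemma gram_corner (k : corner H) f i j :
  (adj (ip (val k) f) *m ip (val k) f) i j =
  (corner_dot k (corner_coord i f))^* * corner_dot k (corner_coord j f).
Proof.
rewrite gram_entry (bigD1 0) //= big1 ?addr0 => [|l l0].
  by rewrite !coord_corner.
by rewrite !coord_corner (negPf l0) !(dot0l corner_dotP) rmorph0 mul0r.
Qed.

(** Membership in the corner is read off a matrix that T preserves: its (i, i) entry is a sum of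
    squares containing <f_i, f_i>^2. *)
Lemma is_corner_gram f :
  reflect (forall i, i != 0 -> (adj (ip f f) *m ip f f) i i = 0) (is_corner f).
Proof.
apply: (iffP (is_cornerP f)) => f0 i i0.
  rewrite gram_entry big1 // => l _.
  by rewrite (f0 i i0) (dot0r corner_dotP) mulr0.
apply: (dot_eq0 corner_dotP); apply/eqP; rewrite -ip_coord -normr_eq0 -sqrf_eq0.
have /eqP := f0 i i0; rewrite adj_trC mul_trC_diag psumr_eq0.
  by move=> /allP/(_ i); rewrite mem_index_enum => /(_ isT).
by move=> l _; rewrite exprn_ge0.
Qed.

(** * Extension of a corner operator to the module *)

Section CoordinatewiseMap.
Variables (th : {rmorphism C -> C}) (U : corner H -> corner H).
Hypothesis thE : th =1 id \/ th =1 Num.conj.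
Hypothesis UD : forall k l, U (k + l) = U k + U l.
Hypothesis UZ : forall a k, U (a *: k) = th a *: U k.
Hypothesis U_dot : forall k l,
  corner_dot (U k) (U l) = th (corner_dot k l).

Definition lift_map f : H := pack (fun i => U (corner_coord i f)).

Lemma coord_lift_map i f :
  corner_coord i (lift_map f) = U (corner_coord i f).
Proof. exact: packK. Qed.

Lemma lift_mapD f g : lift_map (f + g) = lift_map f + lift_map g.
Proof.
by apply: coord_inj => i; rewrite coordD !coord_lift_map coordD UD.
Qed.

Lemma lift_map_scalar a f : lift_map (a%:M *: f) = (th a)%:M *: lift_map f.
Proof.
by apply: coord_inj => i; rewrite coord_scalar !coord_lift_map coord_scalar UZ.
Qed.

Lemma ip_lift_map f g i j : ip (lift_map f) (lift_map g) i j = th (ip f g i j).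
Proof. by rewrite !ip_coord !coord_lift_map U_dot. Qed.

Lemma lift_map_bij : (forall l, exists k, U k = l) -> bijective lift_map.
Proof.
move=> /choice[W WK]; apply: inj_surj_bij => [f g fg|f].
  apply: coord_inj => i; apply/eqP; rewrite -subr_eq0; apply/eqP.
  apply: (dot_eq0 corner_dotP); apply/eqP; rewrite -(fmorph_eq0 th) -U_dot.
  rewrite UD -scaleN1r UZ rmorphN1 scaleN1r -!coord_lift_map.
  by rewrite fg subrr (dot0l corner_dotP).
exists (pack (fun i => W (corner_coord i f))); apply: coord_inj => i.
by rewrite coord_lift_map packK WK.
Qed.

(** By [coordZ] a matrix acts through its entries, which U passes through [th]; hence the
    restriction to the linear case. *)
Lemma lift_mapZ : th =1 id -> forall a f, lift_map (a *: f) = a *: lift_map f.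
Proof.
move=> th1 a f; apply: coord_inj => i; rewrite coordZ !coord_lift_map coordZ.
have U0 : U 0 = 0 by apply: (addIr (U 0)); rewrite -UD !add0r.
rewrite (big_morph U UD U0); apply: eq_bigr => j _.
by rewrite UZ th1 coord_lift_map.
Qed.

End CoordinatewiseMap.

End HilbertModule.

Lemma phase_functionP (R : realType) (X : Type) (P : X -> complex R -> Prop) :
  (forall f, exists2 c, `|c| = 1 & P f c) ->
  exists2 phi, phase_function phi & forall f, P f (phi f).
Proof.
move=> ex; have /choice[phi phiP] : forall f, exists c, `|c| = 1 /\ P f c.
  by move=> f; have [c c1 Pc] := ex f; exists c.
exists phi => f; last by case: (phiP f).
(* The norm of the closed field is complex-valued; its real part is [Normc.normc]. *)
by have [/(congr1 (@complex.Re R))] := phiP f.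
Qed.

(* d = n.+1 >= 1, A = 'M[complex R]_n.+1 *)
Theorem theorem1 (R : realType) (n : nat) (H : lmodType 'M[complex R]_n.+1)
    (ip : H -> H -> 'M[complex R]_n.+1)
    (hH : hilbert_module ip)
    (hgh : exists g h : H, ip g h = 1%:M)
    (T : H -> H)
    (hTsurj : forall y : H, exists x : H, T x = y)
    (hT : forall f f' : H, absm (ip (T f) (T f')) = absm (ip f f')) :
  ((0 < n)%N ->
     exists (U : H -> H) (phi : H -> complex R),
       [/\ A_unitary ip U, phase_function phi &
           forall f : H, T f = (phi f)%:M *: U f]) /\
  (n = 0%N ->
     exists (U : H -> H) (phi : H -> complex R),
       [/\ unitary ip U \/ antiunitary ip U, phase_function phi &
           forall f : H, T f = (phi f)%:M *: U f]).
Proof.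
have dotP := corner_dotP hH; set dot := corner_dot ip in dotP.
have T_gram f g : adj (ip (T f) (T g)) *m ip (T f) (T g) =
                  adj (ip f g) *m ip f g.
  by rewrite -!absm_sqr hT.
have T_corner f : is_corner (T f) = is_corner f.
  by apply/(is_corner_gram hH)/(is_corner_gram hH) => f0 i /f0; rewrite T_gram.
have TKP (k : corner H) : is_corner (T (val k)).
  by rewrite T_corner; apply: valP.
pose TK k : corner H := Sub _ (TKP k).
have TK_products k f i j :
    (dot (TK k) (corner_coord i (T f)))^* * dot (TK k) (corner_coord j (T f)) =
    (dot k (corner_coord i f))^* * dot k (corner_coord j f).
  by rewrite -!(gram_corner hH) -(T_gram (val k) f).
have TK_dot k l : `|dot (TK k) (TK l)| = `|dot k l|.
  apply/eqP; rewrite -(@eqrXn2 _ 2) // !normCK mulrC [X in _ == X]mulrC.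
  have := TK_products k (val l) 0 0.
  by rewrite -[T (val l)]/(val (TK l)) !coord_corner => ->.
have [th thE [U [UD UZ U_dot TU]]] := wigner dotP TK_dot.
have thK c : th (th c) = c by case: thE => E; rewrite !E ?conjCK.
(* A T-preimage f of l lies in the corner by [T_corner], and l = c Uf = U(th c f) because [th] is an
   involution. *)
have U_surj l : exists k, U k = l.
  have [f Tf] := hTsurj (val l).
  have fK : is_corner f by rewrite -T_corner Tf; apply: valP.
  have [c _ TKc] := TU (Corner fK); exists (th c *: Corner fK).
  by rewrite UZ thK -TKc; apply: val_inj.
have U_products k f i j :
    (dot (U k) (corner_coord i (T f)))^* * dot (U k) (corner_coord j (T f)) =
    (dot k (corner_coord i f))^* * dot k (corner_coord j f).
  rewrite -(TK_products k f i j); have [c c1 ->] := TU k.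
  rewrite !(dotZl dotP) rmorphM /= mulrACA [c^* * c]mulrC -normCK c1.
  by rewrite expr1n mul1r.
pose UH := lift_map U.
have UH_bij : bijective UH by apply: (lift_map_bij hH UD UZ U_dot U_surj).
have UH_ip f g i j : ip (UH f) (UH g) i j = th (ip f g i j).
  exact: (ip_lift_map hH U_dot).
case: (thE) => th1.
  have [phi phi1 Tphi] : exists2 phi, phase_function phi &
      forall f, T f = (phi f)%:M *: UH f.
    apply: (phase_functionP (P := fun f c => T f = c%:M *: UH f)) => f.
    have [|c c1 Tc] := products_phase dotP
      (f := fun i => U (corner_coord i f)) (y := fun i => corner_coord i (T f)).
      (* Surjectivity of U lets the test vector range over the whole corner. *)
      move=> l i j; have [k <-] := U_surj l.
      by rewrite U_products !U_dot !th1.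
    exists c => //; apply: coord_inj => i.
    by rewrite coord_scalar coord_lift_map.
  have UH_uni : A_unitary ip UH.
    split=> // [f g|a f|f g].
    - exact: lift_mapD.
    - exact: (lift_mapZ UD UZ).
    - by apply/matrixP=> i j; rewrite UH_ip th1.
  split=> [_|_]; exists UH, phi; split=> //.
  left; case: UH_uni => UHb UHD UHZ UHip; split=> // l f; exact: UHZ.
have th_conj c : th c = c^* by exact: th1.
split=> [n_gt0|n0].
  have [g [h gh]] := hgh; pose i1 : 'I_n.+1 := Ordinal (n_gt0 : 1 < n.+1)%N.
  (* [g, h] = 1 makes the coordinates of g and h biorthogonal, and conjugation fixes the values 0
     and 1. *)
  have gh_dot i j :
      dot (U (corner_coord i g)) (U (corner_coord j h)) = (i == j)%:R.
    by rewrite U_dot /dot -(ip_coord hH) gh mxE rmorph_nat.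
  exfalso; apply: (no_conjugate_products dotP
    (f := fun i => U (corner_coord i h)) (y := fun i => corner_coord i (T h))
    (g := fun i => U (corner_coord i g)) (i := 0) (j := i1)).
  - move=> l i j; have [k <-] := U_surj l.
    by rewrite U_products !U_dot !th_conj conjCK.
  - by rewrite gh_dot.
  - by rewrite gh_dot eqxx.
  - by rewrite gh_dot.
have ord_0 (i : 'I_n.+1) : i = 0.
  by apply/val_inj; case: i => m /= m_lt; move: m_lt; rewrite n0; case: m.
have [phi phi1 Tphi] : exists2 phi, phase_function phi &
    forall f, T f = (phi f)%:M *: UH f.
  apply: (phase_functionP (P := fun f c => T f = c%:M *: UH f)) => f.
  (* For d = 1 the corner is all of H, so the phase comes directly from Wigner's theorem. *)
  have fK : is_corner f by apply/is_cornerP => i; rewrite (ord_0 i).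
  have [c c1 TKc] := TU (Corner fK); exists c => //.
  apply: coord_inj => i; rewrite coord_scalar coord_lift_map (ord_0 i).
  rewrite -[f]/(val (Corner fK)) -[T _]/(val (TK _)).
  by rewrite !coord_corner TKc.
exists UH, phi; split=> //; right; split=> // [f g|l f|f g].
- exact: lift_mapD.
- by rewrite /UH (lift_map_scalar UZ) th_conj.
- apply/matrixP=> i j; rewrite UH_ip th_conj (ord_0 i) (ord_0 j).
  by rewrite [in RHS](ipC hH) adjE.
Qed.
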